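(* Suppose the self-similar measure $\mu$ satisfies the standard technical assumptions. Then the essential class $\Omega_0$ is of positive type, i.e. there is an admissible path $\eta$ all of whose members are in $\Omega_0$ such that all entries of the transition matrix $T(\eta)$ are strictly positive.
   Context: Measure. Let $m\ge 1$, $0<\varrho<1$, $d_0<\dots<d_m$ real, $S_j(x)=\varrho x+d_j$, $\mathcal A=\{0,\dots,m\}$. For $\sigma=(j_1,\dots,j_n)\in\mathcal A^n$ put $S_\sigma=S_{j_1}\circ\cdots\circ S_{j_n}$. Given $p_j>0$ with $\sum_j p_j=1$, $\mu$ is the unique Borel probability measure with $\mu=\sum_{j=0}^m p_j\,\mu\circ S_j^{-1}$. It is of finite type if there is a finite set $F\subset[0,\infty)$ such that for all $n\ge1$ and $\sigma,\sigma'\in\mathcal A^n$ either $\varrho^{-n}|S_\sigma(0)-S_{\sigma'}(0)|>c$ or $\varrho^{-n}|S_\sigma(0)-S_{\sigma'}(0)|\in F$, where $c=(1-\varrho)^{-1}(d_m-d_0)$. Standard technical assumptions: $\mu$ is such a measure and is of finite type; $p_0=p_m=\min_j p_j$; and $\operatorname{supp}\mu=[0,1]$ (equivalently $d_0=0$, $d_m=1-\varrho$, $d_{i+1}-d_i\le\varrho$ for all $i$). Net intervals and characteristic vectors. For $n\ge1$ let $h_1<\dots<h_{s_n}$ be the distinct elements of $\{S_\sigma(0),S_\sigma(1):\sigma\in\mathcal A^n\}$; the net intervals of level $n$ are $\mathcal F_n=\{[h_j,h_{j+1}]:1\le j<s_n\}$, and $\mathcal F_0=\{[0,1]\}$. Each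 $\Delta\in\mathcal F_n$ ($n\ge1$) lies in a unique $\widehat\Delta\in\mathcal F_{n-1}$, its parent ($\Delta$ is a child of $\widehat\Delta$). For $\Delta=[a,b]\in\mathcal F_n$ put $\ell_n(\Delta)=\varrho^{-n}(b-a)$, and let $V_n(\Delta)=(a_1,\dots,a_k)$ be the increasing list of the distinct values $\varrho^{-n}(a-S_\sigma(0))$ over $\sigma\in\mathcal A^n$ with $\Delta\subseteq S_\sigma[0,1]$. Let $r_n(\Delta)$ be the position of $\Delta$, from left to right, among the children of $\widehat\Delta$ with the same $\ell_n$ and $V_n$. The characteristic vector is $\mathcal C_n(\Delta)=(\ell_n(\Delta),V_n(\Delta),r_n(\Delta))$, with $\mathcal C_0([0,1])=(1,(0),1)$. $\Omega$ is the (finite) set of all characteristic vectors. $\beta\in\Omega$ is a child of $\alpha\in\Omega$ (its parent) if $\alpha=\mathcal C_{n-1}(\widehat\Delta)$, $\beta=\mathcal C_n(\Delta)$ for some parent/child pair. An admissible path is a tuple $(\gamma_1,\dots,\gamma_n)$ in $\Omega$ with each $\gamma_j$ the parent of $\gamma_{j+1}$. Transition matrices. For $\Delta=[a,b]\in\mathcal F_n$ with parent $\widehat\Delta=[c,d]$, $V_n(\Delta)=(a_1,\dots,a_K)$, $V_{n-1}(\widehat\Delta)=(c_1,\dots,c_J)$, the primitive transition matrix $T(\mathcal C_{n-1}(\widehat\Delta),\mathcal C_n(\Delta))$ is the $J\times K$ matrix with $(j,k)$ entry $p_0^{-1}p_\ell$ if $\ell\in\mathcal A$ satisfies $c-\varrho^{n-1}c_j+\varrho^{n-1}d_\ell=a-\varrho^na_k$,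 and $0$ if there is no such $\ell$ (it depends only on the two characteristic vectors). For an admissible path with $n\ge2$, $T(\gamma_1,\dots,\gamma_n)=T(\gamma_1,\gamma_2)\cdots T(\gamma_{n-1},\gamma_n)$. Loop and essential classes. A non-empty $\Omega'\subseteq\Omega$ is a loop class if for all $\alpha,\beta\in\Omega'$ there is an admissible path $(\gamma_1,\dots,\gamma_n)$, $n\ge2$, with all $\gamma_j\in\Omega'$, $\gamma_1=\alpha$, $\gamma_n=\beta$. The essential class $\Omega_0$ is the loop class with the further property that every child in $\Omega$ of an element of $\Omega_0$ is in $\Omega_0$; there is exactly one such class (a known result of Feng). *)

(* Defs.v *)
From mathcomp Require Import all_boot all_order all_algebra.
From mathcomp Require Import all_classical all_reals all_analysis.
Set Implicit Arguments.
Unset Strict Implicit.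
Unset Printing Implicit Defensive.
Import Order.TTheory GRing.Theory Num.Theory.
Import numFieldNormedType.Exports.
Local Open Scope classical_set_scope.
Local Open Scope ring_scope.

Section SelfSimilarMeasure.
Context {R : realType} {m : nat}.
Implicit Types (rho : R) (d p : 'I_m.+1 -> R).

Definition sim rho d (j : 'I_m.+1) (x : R) : R := rho * x + d j.

(* [:: j_1; ...; j_n] is mapped to S_{j_1} \o ... \o S_{j_n}. *)
Definition sim_word rho d (s : seq 'I_m.+1) (x : R) : R :=
  foldr (sim rho d) x s.

Definition self_similar rho d p (mu : probability (measurableTypeR R) R) :=
  forall A : set (measurableTypeR R), measurable A ->
    mu A = (\sum_(j < m.+1) (p j)%:E * mu (sim rho d j @^-1` A))%E.

Definition msupport (mu : probability (measurableTypeR R) R) : set R :=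
  [set x | forall U : set R, open U -> U x -> (0 < mu U)%E].

Definition finite_type rho d :=
  exists F : set R,
    [/\ finite_set F, F `<=` [set x | 0 <= x] &
      forall (n : nat) (s t : n.-tuple 'I_m.+1), (1 <= n)%N ->
        let dist := rho ^- n * `|sim_word rho d s 0 - sim_word rho d t 0| in
        dist > (1 - rho)^-1 * (d ord_max - d ord0) \/ F dist].

End SelfSimilarMeasure.

(* (length, neighbour list, position); the position counts from 1. *)
Definition cvec (R : realType) : Type := (R * seq R * nat)%type.

Definition nbhs_list {R : realType} (g : cvec R) : seq R := g.1.2.

Section NetIntervals.
Context {R : realType} {m : nat}.
Implicit Types (rho : R) (d p : 'I_m.+1 -> R) (n : nat).
(* The pair (a, b) stands for the interval [a, b]. *)
Implicit Types (D E : R * R).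

Definition endpoints rho d n : seq R :=
  sort <=%R (undup [seq sim_word rho d (tval s) e
                   | s <- enum {: n.-tuple 'I_m.+1}, e <- [:: 0; 1]]).

(* Listed from left to right. At level 0 the endpoints are 0 and 1, and the
   only net interval is [0, 1]. *)
Definition net_intervals rho d n : seq (R * R) :=
  zip (endpoints rho d n) (behead (endpoints rho d n)).

Definition sub_itv D E : bool := (E.1 <= D.1) && (D.2 <= E.2).

(* The parent in level n of a net interval of level n.+1. *)
Definition parent rho d n D : R * R :=
  head (0, 1) [seq E <- net_intervals rho d n | sub_itv D E].

Definition children rho d n E : seq (R * R) :=
  [seq D <- net_intervals rho d n.+1 | sub_itv D E].

Definition nlength rho n D : R := rho ^- n * (D.2 - D.1).

(* S_sigma is increasing, so S_sigma[0,1] = [S_sigma 0, S_sigma 1]. *)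
Definition neighbours rho d n D : seq R :=
  sort <=%R (undup
    [seq rho ^- n * (D.1 - sim_word rho d (tval s) 0)
    | s <- enum {: n.-tuple 'I_m.+1} &
      sub_itv D (sim_word rho d (tval s) 0, sim_word rho d (tval s) 1)]).

Definition position rho d n D : nat :=
  if n is n'.+1 then
    (index D [seq D' <- children rho d n' (parent rho d n' D)
             | (nlength rho n D' == nlength rho n D) &&
               (neighbours rho d n D' == neighbours rho d n D)]).+1
  else 1%N.

Definition charvec rho d n D : cvec R :=
  (nlength rho n D, neighbours rho d n D, position rho d n D).

Definition Omega rho d : set (cvec R) :=
  [set g | exists n D, D \in net_intervals rho d n /\ g = charvec rho d n D].

(* D, of level n.+1, and its parent, of level n, have characteristic vectors
   b and a. *)
Definition realizes rho d (a b : cvec R) (nD : nat * (R * R)) : Prop :=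
  let: (n, D) := nD in
  [/\ D \in net_intervals rho d n.+1,
      a = charvec rho d n (parent rho d n D) & b = charvec rho d n.+1 D].

Definition is_child rho d (a b : cvec R) : Prop :=
  exists nD, realizes rho d a b nD.

(* The path (g, s_1, ..., s_k), of length k.+1. *)
Definition admissible rho d (g : cvec R) (s : seq (cvec R)) : Prop :=
  {in g :: s, forall x, Omega rho d x} /\
  path (fun a b => `[< is_child rho d a b >]) g s.

(* The matrix depends only on a and b, so it is computed from an arbitrary
   choice of the net interval D; it is meaningful only if b is a child of a. *)
Definition transition rho d p (a b : cvec R) :
    'M[R]_(size (nbhs_list a), size (nbhs_list b)) :=
  let: (n, D) := xget (0%N, (0, 1)) [set nD | realizes rho d a b nD] in
  \matrix_(j, k)
    if [pick l : 'I_m.+1 |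
         (parent rho d n D).1 - rho ^+ n * (nbhs_list a)`_j + rho ^+ n * d l
         == D.1 - rho ^+ n.+1 * (nbhs_list b)`_k] is Some l
    then (p ord0)^-1 * p l else 0.

(* For s = [::] this is an identity matrix; T is only defined on paths with at
   least two members, that is, s <> [::]. *)
Fixpoint path_transition rho d p (g : cvec R) (s : seq (cvec R)) :
    'M[R]_(size (nbhs_list g), size (nbhs_list (last g s))) :=
  match s with
  | [::] => 1%:M
  | b :: s' => transition rho d p g b *m path_transition rho d p b s'
  end.

Definition loop_class rho d (O : set (cvec R)) : Prop :=
  [/\ O !=set0, O `<=` Omega rho d &
    forall a b, O a -> O b ->
      exists s, [/\ s <> [::], admissible rho d a s,
                    {in a :: s, forall g, O g} & last a s = b]].

Definition essential_class rho d (O : set (cvec R)) : Prop :=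
  loop_class rho d O /\ forall a b, O a -> is_child rho d a b -> O b.

Definition positive_type rho d p (O : set (cvec R)) : Prop :=
  exists (g : cvec R) (s : seq (cvec R)),
    [/\ s <> [::], admissible rho d g s, {in g :: s, forall x, O x} &
        forall j k, 0 < path_transition rho d p g s j k].

End NetIntervals.

(* Main.v *)
(* Finite type bounds the number of neighbours of a net interval. Fix a net
   interval D0 with the maximal number of neighbours. If S_t[0,1] covers a net
   interval E, then some S_{tw}[0,1] lies inside E, and a net interval at the
   left end of S_{tw}(D0) has, by maximality, only neighbours that descend from
   t. Start from E whose characteristic vector is in the essential class and do
   this successively for all the words t that cover E; since the neighbours of
   a descendant interval descend from neighbours of the earlier one, this ends
   with some D inside E all of whose neighbours descend from every neighbour of
   E. This says that all the entries of the transition matrix of the path from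
   E to D are positive. *)
Require Import Defs.
From mathcomp Require Import all_boot all_order all_algebra.
From mathcomp Require Import all_classical all_reals all_analysis measurable_realfun.
From mathcomp Require Import lra ring.
Set Implicit Arguments.
Unset Strict Implicit.
Unset Printing Implicit Defensive.
Import Order.TTheory GRing.Theory Num.Theory.
Import numFieldNormedType.Exports.
Local Open Scope classical_set_scope.
Local Open Scope ring_scope.

(** * Consequences of full support *)

Section Support.
Context {R : realType} {m : nat} {rho : R} {d p : 'I_m.+1 -> R}.
Context {mu : probability (measurableTypeR R) R}.
Hypothesis rho01 : 0 < rho < 1.
Hypothesis p_gt0 : forall j, 0 < p j.
Hypothesis mu_ss : self_similar rho d p mu.

(** A point outside the support has a null neighbourhood, hence lies in a null interval with
    rational ends. There are countably many of these, so together they form a null cover of [A]. *)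
Lemma measure_disjoint_msupport (A : set (measurableTypeR R)) :
  measurable A -> A `&` msupport mu = set0 -> mu A = 0%E.
Proof.
move=> mA A0; apply: measure_negligible => //.
pose I (q : rat * rat) : set (measurableTypeR R) := `]ratr q.1, ratr q.2[%classic.
(* [B] enumerates the null rational intervals; every other index contributes the empty set. *)
pose B k := if unpickle k is Some q then
  if mu (I q) == 0%E then I q else set0 else set0.
have mI q : measurable (I q) by exact: measurable_itv.
apply: (@negligibleS _ _ _ _ (\bigcup_k B k)); last first.
  apply: negligible_bigcup => k; rewrite /B.
  case: unpickle => [q|]; last exact: negligible_set0.
  by case: eqP => [/negligibleP|_]; [apply|exact: negligible_set0].
move=> x Ax; have /existsNP[V /not_implyP[oV /not_implyP[Vx /negP]]] : ~ msupport mu x.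
  by move=> Sx; have : (A `&` msupport mu) x by []; rewrite A0.
rewrite -leNgt => muV.
have /nbhs_ballP[e /= e0 xeV] : nbhs x V by apply: open_nbhs_nbhs.
have [q1] := @rat_in_itvoo R (x - e) x ltac:(lra); rewrite in_itv /= => q1x.
have [q2] := @rat_in_itvoo R x (x + e) ltac:(lra); rewrite in_itv /= => q2x.
have Bq q : B (pickle q) = if mu (I q) == 0%E then I q else set0.
  by rewrite /B pickleK.
move: (pickle _) (Bq (q1, q2)) => k Bk; exists k => //; rewrite {}Bk.
have IV : I (q1, q2) `<=` V.
  move=> y; rewrite /I /= in_itv /= => qy; apply: xeV.
  by rewrite /ball /= ltr_norml; lra.
have -> : mu (I (q1, q2)) == 0%E.
  rewrite eq_le measure_ge0 andbT (le_trans _ muV) // le_measure // inE //.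
  exact: open_measurable.
by rewrite /I /= in_itv /=; lra.
Qed.

Lemma continuous_sim j : continuous (sim rho d j).
Proof.
move=> x; rewrite /sim; apply: cvgD; last exact: cvg_cst.
exact: mulrl_continuous.
Qed.

Lemma measurable_sim_preimage j (U : set R) : open U ->
  measurable (sim rho d j @^-1` U : set (measurableTypeR R)).
Proof.
by move=> oU; apply: open_measurable; apply: open_comp => // x _; exact: continuous_sim.
Qed.

(** In the self-similarity identity for [U], the [j]-th term alone is positive, because the preimage
    of [U] is an open neighbourhood of [x]. *)
Lemma msupport_sim j x : msupport mu x -> msupport mu (sim rho d j x).
Proof.
move=> Sx U oU Ux; rewrite mu_ss; last exact: open_measurable.
rewrite (bigD1 j) //=.
have pos : (0 < (p j)%:E * mu (sim rho d j @^-1` U))%E.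
  rewrite mule_gt0 ?lte_fin //; apply: Sx => //.
  by apply: open_comp => // y _; exact: continuous_sim.
apply: (lt_le_trans pos); rewrite leeDl // sume_ge0 // => i _.
by rewrite mule_ge0 // lee_fin ltW.
Qed.

Hypothesis mu_supp : msupport mu = [set x | 0 <= x <= 1].

(** Otherwise the complement [U] of the finitely many closed intervals S_j[0,1] is an open
    neighbourhood of [x]. Its preimages under all the S_j miss the support [0,1], so self-similarity
    makes [U] null, although [x] is in the support. *)
Lemma unit_itv_cover (x : R) : 0 <= x <= 1 -> exists j, 0 <= x - d j <= rho.
Proof.
move=> x01; apply: contrapT => /forallNP xd.
pose U : set R := ~` \bigcup_(j in [set: 'I_m.+1]) `[d j, d j + rho]%classic.
have oU : open U.
  by rewrite openC; apply: closed_bigcup => [|j _]; [exact: finite_finset|exact: itv_closed].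
have Ux : U x.
  by case=> j _; rewrite /= in_itv /= => xj; apply: (xd j); lra.
have : msupport mu x by rewrite mu_supp.
move/(_ U oU Ux); rewrite mu_ss; last exact: open_measurable.
rewrite big1 ?ltxx // => j _; rewrite measure_disjoint_msupport ?mule0 //.
  exact: measurable_sim_preimage.
rewrite mu_supp -subset0 => y [Uy /= y01]; apply: Uy; exists j => //.
by rewrite /= in_itv /= /sim; move: rho01; nra.
Qed.

(** Each S_j maps the support [0,1] into itself; the images of 0 and 1 give the two bounds. *)
Lemma translation_itv j : 0 <= d j <= 1 - rho.
Proof.
have supp01 x : msupport mu x -> 0 <= x <= 1 by rewrite mu_supp.
have /supp01 : msupport mu (sim rho d j 0).
  by apply: msupport_sim; rewrite mu_supp /= lexx ler01.
have /supp01 : msupport mu (sim rho d j 1).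
  by apply: msupport_sim; rewrite mu_supp /= lexx ler01.
by rewrite /sim; lra.
Qed.

Hypothesis d_lt : forall i j : 'I_m.+1, (i < j)%N -> d i < d j.

Lemma translation_le (i j : 'I_m.+1) : (i <= j)%N -> d i <= d j.
Proof.
by rewrite leq_eqVlt => /predU1P[/val_inj->//|/d_lt/ltW].
Qed.

Lemma translation_ord0 : d ord0 = 0.
Proof.
have [|j dj] := unit_itv_cover (x := 0); first lra.
have := translation_itv ord0; have := translation_le (leq0n j : ord0 <= j)%N; lra.
Qed.

Lemma translation_ord_max : d ord_max = 1 - rho.
Proof.
have [|j dj] := unit_itv_cover (x := 1); first lra.
have := translation_itv ord_max.
have := translation_le (leq_ord j : j <= ord_max)%N; lra.
Qed.

End Support.

(** * Words and net intervals *)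

Section Consecutive.
Context {R : realType}.
Implicit Types (s : seq R) (D E : R * R).

(** This replaces the list encoding of net intervals by a condition on endpoints, through which all
    later arguments pass. *)
Lemma mem_consecutive s D : sorted <%R s ->
  D \in zip s (behead s) <->
  [/\ D.1 \in s, D.2 \in s, D.1 < D.2 & forall x, x \in s -> ~~ (D.1 < x < D.2)].
Proof.
case: D => a b /=; elim: s => [|y [|z s] IH] //=.
- by move=> _; split=> // -[].
- move=> _; split=> // -[]; rewrite !inE => /eqP-> /eqP->.
  by rewrite ltxx.
case/andP=> yz sz; have minz x : x \in z :: s -> z <= x.
  rewrite inE => /predU1P[->//|xs]; apply: ltW.
  by have /allP := order_path_min lt_trans sz; apply.
have miny x : x \in z :: s -> y < x by move/minz; exact: lt_le_trans.
split.
- rewrite in_cons => /predU1P[[-> ->]|/(IH sz)[az bz ab nob]].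
    split; [exact: mem_head|by rewrite in_cons mem_head orbT|exact: yz|move=> x].
    rewrite in_cons => /predU1P[->|/minz]; first by rewrite ltxx.
    by rewrite leNgt => /negbTE->; rewrite andbF.
  split; [by rewrite in_cons az orbT|by rewrite in_cons bz orbT|by []|move=> x].
  rewrite in_cons => /predU1P[->|]; last exact: nob.
  by rewrite ltNge (ltW (miny _ az)).
- case=> ay bys ab nob.
  have bz : b \in z :: s.
    move: bys; rewrite in_cons => /predU1P[eb|//]; move: ay; rewrite in_cons.
    move=> /predU1P[ea|/miny]; first by move: ab; rewrite ea eb ltxx.
    by move=> ya; move: (lt_trans ya ab); rewrite eb ltxx.
  rewrite in_cons; move: ay; rewrite in_cons => /predU1P[ea|az].
    have := nob z; rewrite !inE eqxx orbT => /(_ isT).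
    rewrite ea yz /= -leNgt => lebz.
    by have -> : b = z; [apply/eqP; rewrite eq_le lebz minz|rewrite eqxx].
  apply/orP; right; apply/(IH sz); split=> // x xs.
  by apply: nob; rewrite in_cons xs orbT.
Qed.

(** The half-open condition lets [x] be a member of the list itself; the pair found is then the one
    that starts at [x]. *)
Lemma consecutive_around {s lo hi x} : sorted <%R s ->
  lo \in s -> hi \in s -> lo <= x < hi ->
  exists2 D, D \in zip s (behead s) & D.1 <= x < D.2.
Proof.
elim: s lo => [|y [|z s] IH] //= lo.
  by rewrite !inE => _ /eqP-> /eqP->; case: ltgtP.
case/andP=> yz sz los his /andP[lox xhi].
have yle w : w \in [:: y, z & s] -> y <= w.
  rewrite inE => /predU1P[->//|ws]; apply: ltW.
  have yzs : path <%R y (z :: s) by rewrite /= yz.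
  by move/allP: (order_path_min lt_trans yzs); apply.
have [xz|zx] := ltP x z.
  exists (y, z); rewrite ?mem_head //=.
  by rewrite xz (le_trans (yle _ los) lox).
have hiz : hi \in z :: s.
  move: his; rewrite in_cons => /predU1P[ehi|//].
  by move: (lt_trans yz (le_lt_trans zx xhi)); rewrite ehi ltxx.
have [|D Ds Dx] := IH z sz (mem_head _ _) hiz; first by rewrite zx xhi.
by exists D => //; rewrite in_cons Ds orbT.
Qed.

(** A list sorted by this strict relation is determined by its members, which later identifies lists
    of children together with their order. *)
Definition lt_left : rel (R * R) := fun D E => D.1 < E.1.

Lemma lt_left_trans : transitive lt_left.
Proof. by move=> ? ? ?; apply: lt_trans. Qed.

Lemma lt_left_irr : irreflexive lt_left.
Proof. by move=> D; apply: ltxx. Qed.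

Lemma sorted_consecutive s : sorted <%R s -> sorted lt_left (zip s (behead s)).
Proof.
elim: s => [|y [|z [|w s]] IH] //= /andP[yz sz].
by rewrite /lt_left /= yz; exact: IH.
Qed.

End Consecutive.

Section Words.
Context {R : realType} {m : nat} {rho : R} {d : 'I_m.+1 -> R}.
Hypothesis rho01 : 0 < rho < 1.
Hypothesis d01 : forall j, 0 <= d j <= 1 - rho.
Hypothesis d_lo : d ord0 = 0.
Hypothesis d_hi : d ord_max = 1 - rho.
Hypothesis d_cover : forall x : R, 0 <= x <= 1 -> exists j, 0 <= x - d j <= rho.
Local Notation S := (sim_word rho d).
Local Notation covers s D := (sub_itv D (S s 0, S s 1)).
Implicit Types (s t : seq 'I_m.+1) (D E : R * R).

Let rho_gt0 : 0 < rho. Proof. by case/andP: rho01. Qed.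
Let rho_ge0 : 0 <= rho. Proof. exact: ltW. Qed.
Let rho_neq0 : rho != 0. Proof. by rewrite gt_eqF. Qed.
Let rhoX_gt0 n : 0 < rho ^+ n. Proof. exact: exprn_gt0. Qed.
Let rhoX_neq0 n : rho ^+ n != 0. Proof. by rewrite gt_eqF. Qed.

Lemma sim_wordE s x : S s x = rho ^+ size s * x + S s 0.
Proof.
elim: s => [|j s IH] /=; first by rewrite expr0 mul1r addr0.
by rewrite /sim IH exprS; ring.
Qed.

Lemma sim_word_cat s t x : S (s ++ t) x = S s (S t x).
Proof. exact: foldr_cat. Qed.

Lemma sim_word_itv s x : 0 <= x <= 1 -> 0 <= S s x <= 1.
Proof.
move=> x01; elim: s => [//|j s] /=; rewrite /sim; set y := S s x => y01.
by have := d01 j; move: rho01; nra.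
Qed.

Lemma sim_word_le s x y : x <= y -> S s x <= S s y.
Proof. by move=> xy; rewrite (sim_wordE s x) (sim_wordE s y) lerD2r ler_wpM2l // ltW. Qed.

Lemma sim_word_width s : S s 1 = S s 0 + rho ^+ size s.
Proof. by rewrite sim_wordE mulr1 addrC. Qed.

Lemma covers_catl {s t D} : covers (s ++ t) D -> covers s D.
Proof.
rewrite /sub_itv /= !sim_word_cat => /andP[h1 h2].
have /andP[t0 _] : 0 <= S t 0 <= 1 by rewrite sim_word_itv ?lexx ?ler01.
have /andP[_ t1] : 0 <= S t 1 <= 1 by rewrite sim_word_itv ?lexx ?ler01.
by rewrite (le_trans (sim_word_le _ t0) h1)
           (le_trans h2 (sim_word_le _ t1)).
Qed.

Lemma sub_itv_trans {D' D E : R * R} : sub_itv D' D -> sub_itv D E -> sub_itv D' E.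
Proof.
case/andP=> h1 h2 /andP[h3 h4].
by rewrite /sub_itv (le_trans h3 h1) (le_trans h2 h4).
Qed.

Lemma word_cover n s x : S s 0 <= x <= S s 1 ->
  exists2 t, size t = n & S (s ++ t) 0 <= x <= S (s ++ t) 1.
Proof.
elim: n s => [|n IH] s sx; first by exists [::]; rewrite ?cats0.
(* [y] is the preimage of [x] under S_s. A letter whose interval contains [y] can be appended to
   [s]. *)
pose y := rho ^- size s * (x - S s 0).
have xE : x = S s y.
  by rewrite sim_wordE /y mulrA divff // mul1r subrK.
have y01 : 0 <= y <= 1.
  move: sx; rewrite sim_word_width => /andP[h1 h2]; apply/andP; split.
    by rewrite mulr_ge0 ?subr_ge0 // invr_ge0 ltW.
  by rewrite /y mulrC ler_pdivrMr // mul1r; lra.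
have [j dj] := d_cover y01.
have [|t <- tx] := IH (rcons s j).
  rewrite -cats1 !sim_word_cat xE /= /sim mulr0 add0r mulr1.
  by rewrite !sim_word_le //; lra.
by exists (j :: t) => //; rewrite -cat_rcons.
Qed.

(** * Endpoints, net intervals and their nesting *)

Lemma endpointsP n x : x \in endpoints rho d n <->
  exists2 s, size s = n & x = S s 0 \/ x = S s 1.
Proof.
rewrite mem_sort mem_undup; split.
- case/allpairsP=> -[s e] /= [_]; rewrite !inE => he ->.
  by exists s; [exact: size_tuple|case/orP: he => /eqP->; [left|right]].
- case=> s hs xs; apply/allpairsP.
  have hs' : size s == n by apply/eqP.
  by case: xs => ->; [exists (Tuple hs', 0)|exists (Tuple hs', 1)];
    rewrite /= mem_enum ?inE ?eqxx ?orbT.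
Qed.

Lemma sorted_endpoints n : sorted <%R (endpoints rho d n).
Proof. by rewrite sort_lt_sorted undup_uniq. Qed.

(** S_0 fixes 0 and S_m fixes 1, so appending the first or the last letter to a word keeps its left
    or right endpoint. *)
Lemma endpoints_mono {n k x} : (n <= k)%N ->
  x \in endpoints rho d n -> x \in endpoints rho d k.
Proof.
move=> /subnK <-; elim: (k - n)%N => [//|i IH] /IH {IH}.
rewrite addSn => /endpointsP[s hs xs]; apply/endpointsP.
case: xs => ->; [exists (rcons s ord0)|exists (rcons s ord_max)];
  rewrite ?size_rcons ?hs // -cats1 !sim_word_cat /= /sim.
  by rewrite mulr0 d_lo addr0; left.
by right; rewrite mulr1 d_hi addrC subrK.
Qed.

Lemma endpoints0 n : 0 \in endpoints rho d n.
Proof. by apply: (@endpoints_mono 0 n) => //; apply/endpointsP; exists [::] => //; left. Qed.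

Lemma endpoints1 n : 1 \in endpoints rho d n.
Proof. by apply: (@endpoints_mono 0 n) => //; apply/endpointsP; exists [::] => //; right. Qed.

Lemma endpoints_itv n x : x \in endpoints rho d n -> 0 <= x <= 1.
Proof. by case/endpointsP=> s _ [] ->; rewrite sim_word_itv ?lexx ?ler01. Qed.

Lemma net_intervalP n D : D \in net_intervals rho d n <->
  [/\ D.1 \in endpoints rho d n, D.2 \in endpoints rho d n, D.1 < D.2 &
      forall x, x \in endpoints rho d n -> ~~ (D.1 < x < D.2)].
Proof. exact: mem_consecutive (sorted_endpoints n). Qed.

Lemma net_interval_at n u v : u \in endpoints rho d n ->
  v \in endpoints rho d n -> u < v ->
  exists2 w, w <= v & (u, w) \in net_intervals rho d n.
Proof.
move=> un vn uv.
have [|[a b] Dn /andP[au ub]] := consecutive_around (x := u) (sorted_endpoints n) un vn.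
  by rewrite lexx.
have [/= _ bn ab nob] := (net_intervalP _ _).1 Dn.
have aE : a = u.
  apply/eqP; rewrite eq_le au /= leNgt; apply/negP => a_lt.
  by have := nob _ un; rewrite a_lt ub.
subst a; exists b => //.
by rewrite leNgt; apply/negP => vb; have := nob _ vn; rewrite uv vb.
Qed.

(** The ends of [E] are still endpoints at level [k], so none of them is interior to [D];
    overlapping therefore forces inclusion. *)
Lemma sub_net_interval n k D E : (n <= k)%N -> D \in net_intervals rho d k ->
  E \in net_intervals rho d n -> E.1 < D.2 -> D.1 < E.2 -> sub_itv D E.
Proof.
move=> nk /net_intervalP[_ _ _ noD] /net_intervalP[E1 E2 _ _] h1 h2.
have := noD _ (endpoints_mono nk E1); have := noD _ (endpoints_mono nk E2).
by rewrite h1 h2 andbT /= -!leNgt /sub_itv => -> ->.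
Qed.

Lemma ancestor n k D : (n <= k)%N -> D \in net_intervals rho d k ->
  exists2 E, E \in net_intervals rho d n & sub_itv D E.
Proof.
move=> nk Dk; have [D1 D2 D12 _] := (net_intervalP _ _).1 Dk.
have := endpoints_itv D1; have := endpoints_itv D2 => h2 h1.
have [|E En /andP[e1 e2]] := consecutive_around (x := D.1)
    (sorted_endpoints n) (endpoints0 n) (endpoints1 n).
  by lra.
by exists E => //; apply: (sub_net_interval nk Dk En) => //; exact: le_lt_trans e1 D12.
Qed.

Lemma net_interval_unique n D E E' : E \in net_intervals rho d n ->
  E' \in net_intervals rho d n -> D.1 < D.2 ->
  sub_itv D E -> sub_itv D E' -> E = E'.
Proof.
move=> En E'n D12 /andP[h1 h2] /andP[h3 h4].
have /andP[i1 i2] : sub_itv E E' by apply: (sub_net_interval (leqnn n) En E'n); lra.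
have /andP[i3 i4] : sub_itv E' E by apply: (sub_net_interval (leqnn n) E'n En); lra.
by case: E E' {En E'n h1 h2 h3 h4} i1 i2 i3 i4 => a b [a' b'] /= *;
  congr (_, _); lra.
Qed.

Lemma parentE n D E : D \in net_intervals rho d n.+1 ->
  E \in net_intervals rho d n -> sub_itv D E -> parent rho d n D = E.
Proof.
move=> Dn En DE; rewrite /parent; have [_ _ D12 _] := (net_intervalP _ _).1 Dn.
(* The filtered list contains [E] and nothing different from [E], so the default value of [head] is
   never reached. *)
set s := (X in head _ X); have: E \in s by rewrite mem_filter DE.
have: all (fun E' => E' == E) s.
  apply/allP => E'; rewrite mem_filter => /andP[DE' E'n].
  by apply/eqP; exact: net_interval_unique E'n En D12 DE' DE.
by case: s => //= E' s /andP[/eqP].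
Qed.

Lemma parentP n D : D \in net_intervals rho d n.+1 ->
  parent rho d n D \in net_intervals rho d n /\ sub_itv D (parent rho d n D).
Proof.
move=> Dn; have [E En DE] := ancestor (leqnSn n) Dn.
by rewrite (parentE Dn En DE).
Qed.

(** As for nested net intervals: the ends of S_s[0,1] are endpoints of level [n] and cannot be
    interior to [D]. *)
Lemma covers_net_interval s n D : (size s <= n)%N ->
  D \in net_intervals rho d n -> S s 0 < D.2 -> D.1 < S s 1 -> covers s D.
Proof.
move=> sn /net_intervalP[_ _ _ noD] h1 h2.
have e0 : S s 0 \in endpoints rho d n.
  by apply: (endpoints_mono sn); apply/endpointsP; exists s => //; left.
have e1 : S s 1 \in endpoints rho d n.
  by apply: (endpoints_mono sn); apply/endpointsP; exists s => //; right.
have := noD _ e0; have := noD _ e1.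
by rewrite h1 h2 andbT /= -!leNgt /sub_itv => -> ->.
Qed.

Lemma covers_up {s n k D E} : (size s <= n)%N -> (n <= k)%N ->
  D \in net_intervals rho d k -> E \in net_intervals rho d n ->
  sub_itv D E -> covers s D -> covers s E.
Proof.
move=> sn nk /net_intervalP[_ _ D12 _] En /andP[h1 h2] /andP[/= h3 h4].
by apply: (covers_net_interval sn En); lra.
Qed.

(** * Neighbours of a net interval *)

Lemma neighboursP n D x : x \in neighbours rho d n D <->
  exists s, [/\ size s = n, covers s D & x = rho ^- n * (D.1 - S s 0)].
Proof.
rewrite mem_sort mem_undup; split.
- case/mapP=> s; rewrite mem_filter => /andP[cs _] ->.
  by exists s; split=> //; exact: size_tuple.
- case=> s [/eqP hs cs ->]; apply/mapP; exists (Tuple hs) => //.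
  by rewrite mem_filter mem_enum andbT.
Qed.

Lemma sorted_neighbours n D : sorted <%R (neighbours rho d n D).
Proof. by rewrite sort_lt_sorted undup_uniq. Qed.

Lemma neighbours_uniq n D : uniq (neighbours rho d n D).
Proof. by rewrite sort_uniq undup_uniq. Qed.

(** * Children are determined by the characteristic vector *)

(** The position is left out: length and neighbours alone determine the children up to an affine
    map. *)
Definition same_type n E n' E' :=
  [/\ E \in net_intervals rho d n, E' \in net_intervals rho d n',
      nlength rho n E = nlength rho n' E' &
      neighbours rho d n E = neighbours rho d n' E'].

Lemma same_type_sym n E n' E' : same_type n E n' E' -> same_type n' E' n E.
Proof. by case. Qed.

(** The increasing affine map of ratio [rho ^+ n' / rho ^+ n] that sends the left end of [E] to that
    of [E']; intervals of the same type are mapped onto each other. *)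
Definition transport n E n' E' (x : R) : R :=
  E'.1 + rho ^+ n' / rho ^+ n * (x - E.1).

Definition transport_itv n E n' E' D : R * R :=
  (transport n E n' E' D.1, transport n E n' E' D.2).

Lemma transportK n E n' E' :
  cancel (transport n E n' E') (transport n' E' n E).
Proof.
by move=> x; rewrite /transport; field; rewrite !rhoX_neq0.
Qed.

Lemma transport_itvK n E n' E' :
  cancel (transport_itv n E n' E') (transport_itv n' E' n E).
Proof. by case=> x y; rewrite /transport_itv /= !transportK. Qed.

Lemma transport_lt n E n' E' x y :
  (transport n E n' E' x < transport n E n' E' y) = (x < y).
Proof. by rewrite ltrD2l ltr_pM2l ?divr_gt0 // ltrD2r. Qed.

Lemma transport_le n E n' E' x y :
  (transport n E n' E' x <= transport n E n' E' y) = (x <= y).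
Proof. by rewrite lerD2l ler_pM2l ?divr_gt0 // lerD2r. Qed.

Lemma transport_left n E n' E' : transport n E n' E' E.1 = E'.1.
Proof. by rewrite /transport subrr mulr0 addr0. Qed.

Lemma transport_right n E n' E' : same_type n E n' E' ->
  transport n E n' E' E.2 = E'.2.
Proof.
case=> _ _ lE _; rewrite /transport -mulrA.
rewrite [_^-1 * _]lE /nlength mulrA divff // mul1r; ring.
Qed.

(** Equal neighbour lists supply a word [s'] with the same normalised offset from [E'] as [s] has
    from [E]. Two affine maps with the same ratio that agree at one point are equal. *)
Lemma transport_word n E n' E' s : same_type n E n' E' ->
  size s = n -> covers s E ->
  exists s', [/\ size s' = n', covers s' E' &
    forall y, S s' y = transport n E n' E' (S s y)].
Proof.
case=> En E'n' _ VE sn cs.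
have: rho ^- n * (E.1 - S s 0) \in neighbours rho d n' E'.
  by rewrite -VE; apply/neighboursP; exists s.
case/neighboursP=> s' [s'n' cs' eqc]; exists s'; split=> // y.
rewrite (sim_wordE s) (sim_wordE s') sn s'n' /transport.
have -> : S s' 0 = E'.1 - rho ^+ n' * (rho ^- n * (E.1 - S s 0)).
  by rewrite eqc; field; rewrite rhoX_neq0.
by field; rewrite rhoX_neq0.
Qed.

(** The ends of [E] go to the ends of [E'], which survive to the next level. An endpoint inside [E]
    comes from a word [s] followed by a letter [l], where [s] must cover [E]; transporting [s] and
    keeping [l] gives the image. *)
Lemma transport_endpoint n E n' E' x : same_type n E n' E' ->
  x \in endpoints rho d n.+1 -> E.1 <= x <= E.2 ->
  transport n E n' E' x \in endpoints rho d n'.+1.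
Proof.
move=> st xn; have [En E'n' _ _] := st.
have [E'1 E'2 _ _] := (net_intervalP _ _).1 E'n'.
rewrite !le_eqVlt => /andP[/predU1P[<-|x1] /predU1P[->|x2]];
  rewrite ?transport_left ?transport_right //; try exact: endpoints_mono E'1;
  try exact: endpoints_mono E'2.
case/endpointsP: xn => w wn xw.
case/lastP: w wn xw => [//|s l]; rewrite size_rcons -cats1 => -[sn] xw.
have xs : S s 0 <= x <= S s 1.
  have l01 e : 0 <= e <= 1 -> 0 <= S [:: l] e <= 1 by exact: sim_word_itv.
  have /andP[a1 a2] := l01 0 ltac:(by rewrite lexx ler01).
  have /andP[a3 a4] := l01 1 ltac:(by rewrite lexx ler01).
  by case: xw => ->; rewrite sim_word_cat !sim_word_le.
have cs : covers s E.
  by apply: (covers_net_interval _ En); rewrite ?sn //; lra.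
have [s' [s'n' _ s'S]] := transport_word st sn cs.
apply/endpointsP; exists (s' ++ [:: l]); first by rewrite size_cat s'n' addn1.
by case: xw => ->; rewrite !sim_word_cat -s'S; [left|right].
Qed.

Lemma childrenP n D E : D \in children rho d n E <->
  D \in net_intervals rho d n.+1 /\ sub_itv D E.
Proof. by rewrite mem_filter; split=> [/andP[]|[-> ->]]. Qed.

Lemma transport_child n E n' E' D : same_type n E n' E' ->
  D \in children rho d n E ->
  transport_itv n E n' E' D \in children rho d n' E'.
Proof.
move=> st /childrenP[Dn /andP[ED1 ED2]].
have [D1 D2 D12 noD] := (net_intervalP _ _).1 Dn.
have tD1 : E'.1 <= transport n E n' E' D.1.
  by rewrite -(transport_left n E n' E') transport_le.
have tD2 : transport n E n' E' D.2 <= E'.2.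
  by rewrite -(transport_right st) // transport_le.
apply/childrenP; split; last by rewrite /sub_itv /= tD1 tD2.
apply/net_intervalP => /=; split; rewrite ?transport_lt //;
  try by apply: transport_endpoint => //; lra.
move=> x xn'; apply/negP => /andP[x1 x2].
pose y := transport n' E' n E x.
have yx : x = transport n E n' E' y by rewrite transportK.
have : y \in endpoints rho d n.+1.
  by apply: transport_endpoint => //; [exact: same_type_sym|lra].
by move/noD; move: x1 x2; rewrite yx !transport_lt => -> ->.
Qed.

(** A word covering [D] extends a word [s] covering [E] by one letter, and [s] can be transported.
    The reverse inclusion follows from the inverse transport. *)
Lemma sub_transport_neighbours n E n' E' D : same_type n E n' E' ->
  D \in children rho d n E ->
  {subset neighbours rho d n.+1 D <=
          neighbours rho d n'.+1 (transport_itv n E n' E' D)}.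
Proof.
move=> st /childrenP[Dn DE] x /neighboursP[w [wn cw ->]].
have [En _ _ _] := st.
case/lastP: w wn cw => [//|s l]; rewrite size_rcons -cats1 => -[sn] cw.
have cs : covers s E.
  apply: (covers_up _ (leqnSn n) Dn En DE); rewrite ?sn //.
  exact: covers_catl cw.
have [s' [s'n' _ s'S]] := transport_word st sn cs.
apply/neighboursP; exists (s' ++ [:: l]); split.
- by rewrite size_cat s'n' addn1.
- move: cw; rewrite /sub_itv /= !sim_word_cat !s'S.
  by rewrite !transport_le.
- rewrite !sim_word_cat !s'S /= /transport !exprS.
  by field; rewrite rho_neq0 !rhoX_neq0.
Qed.

Lemma transport_neighbours n E n' E' D : same_type n E n' E' ->
  D \in children rho d n E ->
  neighbours rho d n'.+1 (transport_itv n E n' E' D) = neighbours rho d n.+1 D.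
Proof.
move=> st DE; apply: (irr_sorted_eq lt_trans ltxx); try exact: sorted_neighbours.
move=> x; apply/idP/idP; last exact: sub_transport_neighbours.
rewrite -{2}(transport_itvK n E n' E' D); apply: sub_transport_neighbours.
  exact: same_type_sym.
exact: transport_child.
Qed.

Lemma transport_nlength n E n' E' D :
  nlength rho n'.+1 (transport_itv n E n' E' D) = nlength rho n.+1 D.
Proof.
rewrite /nlength /= /transport !exprS.
by field; rewrite rho_neq0 !rhoX_neq0.
Qed.

Lemma sorted_children n E : sorted lt_left (children rho d n E).
Proof.
apply: sorted_filter; first exact: lt_left_trans.
exact: sorted_consecutive (sorted_endpoints _).
Qed.

Lemma transport_children n E n' E' : same_type n E n' E' ->
  children rho d n' E' = map (transport_itv n E n' E') (children rho d n E).
Proof.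
move=> st; apply: (irr_sorted_eq lt_left_trans lt_left_irr).
- exact: sorted_children.
- apply: homo_sorted (sorted_children n E) => D D'.
  by rewrite /lt_left transport_lt.
- move=> D; apply/idP/mapP => [DE'|[D' D'E ->]]; last exact: transport_child.
  exists (transport_itv n' E' n E D); last by rewrite transport_itvK.
  by apply: transport_child => //; exact: same_type_sym.
Qed.

(* The position component of the characteristic vector is what singles out one
   child among those with equal length and neighbours. *)
Lemma realizes_transport {a b n D n' D'} :
  realizes rho d a b (n, D) -> realizes rho d a b (n', D') ->
  D' = transport_itv n (parent rho d n D) n' (parent rho d n' D') D.
Proof.
move=> [Dn aD bD] [D'n' aD' bD'].
have [En DE] := parentP Dn; have [E'n' D'E'] := parentP D'n'.
move: aD; rewrite {}aD' /charvec => -[lE VE _].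
move: bD; rewrite {}bD' /charvec => -[lD VD].
set E := parent rho d n D in En DE lE VE *.
set E' := parent rho d n' D' in E'n' D'E' lE VE *.
have st : same_type n E n' E' by [].
rewrite /position -/E -/E'; set P' := fun _ => _; set P := fun _ => _.
have PP' : {in children rho d n E, P' \o transport_itv n E n' E' =1 P}.
  by move=> C CE; rewrite /P /P' /= transport_nlength transport_neighbours // lD VD.
rewrite (transport_children st) // filter_map (eq_in_filter PP').
set F := (X in _ = index D X) => idx.
(* [D'] is the image of some [C] in the list of candidates for [D]. Transport preserves indices, so
   the equal positions force [C] to be [D]. *)
have: D' \in map (transport_itv n E n' E') F.
  rewrite /F -(eq_in_filter PP') -filter_map -transport_children //.
  rewrite mem_filter /P' !eqxx; exact/childrenP.
case/mapP=> C CF D'E; rewrite D'E; congr transport_itv; move: idx.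
have DF : D \in F by rewrite mem_filter /P !eqxx; exact/childrenP.
rewrite {1}D'E index_map => [eqi|]; last exact: can_inj (transport_itvK _ _ _ _).
by rewrite -(nth_index D CF) eqi nth_index.
Qed.

(** * Positive entries along paths *)

Section Transition.
Context {p : 'I_m.+1 -> R}.
Hypothesis p_gt0 : forall j, 0 < p j.

Lemma transition_ge0 a b j k : 0 <= transition rho d p a b j k.
Proof.
rewrite /transition; case: (xget _ _) => n D; rewrite mxE.
by case: pickP => // l _; rewrite mulr_ge0 ?invr_ge0 // ltW.
Qed.

(** The interval chosen inside [transition] may differ from [D], but it is a transport of [D], and
    transport preserves the equation satisfied by [l]. So some letter is picked, and whichever it
    is, the entry is positive. *)
Lemma transition_gt0 a b n D l
    (j : 'I_(size (nbhs_list a))) (k : 'I_(size (nbhs_list b))) :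
  realizes rho d a b (n, D) ->
  (parent rho d n D).1 - rho ^+ n * (nbhs_list a)`_j + rho ^+ n * d l
    = D.1 - rho ^+ n.+1 * (nbhs_list b)`_k ->
  0 < transition rho d p a b j k.
Proof.
move=> rD eqD; rewrite /transition.
have := xgetI (0%N, (0, 1)) rD.
case: (xget _ _) => n' D' /= rD'; rewrite mxE.
case: pickP => [l' _|/(_ l)/negP[]]; first by rewrite mulr_gt0 ?invr_gt0.
apply/eqP; have := realizes_transport rD rD'.
move: (parent rho d n' D') => E' -> /=.
set x := (nbhs_list a)`_j in eqD *; set y := (nbhs_list b)`_k in eqD *.
have -> : D.1 = (parent rho d n D).1 - rho ^+ n * x + rho ^+ n * d l + rho ^+ n.+1 * y.
  by rewrite eqD subrK.
by rewrite /transport !exprS; field; rewrite rhoX_neq0.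
Qed.

Lemma path_transition_ge0 a (s : seq (cvec R)) j k : 0 <= path_transition rho d p a s j k.
Proof.
elim: s a j k => [|b s IH] a j k /=; first by rewrite mxE ler0n.
by rewrite mxE sumr_ge0 // => i _; rewrite mulr_ge0 ?transition_ge0.
Qed.

Lemma Omega_charvec n D : D \in net_intervals rho d n ->
  Omega rho d (charvec rho d n D).
Proof. by move=> Dn; exists n, D. Qed.

(** The path runs through the characteristic vectors of the ancestors of [D]. Reading [w] letter by
    letter selects one neighbour at each level, and the product of the corresponding entries is a
    positive summand of the entry at [j] and [i]. *)
Lemma exists_path n k D E : E \in net_intervals rho d n ->
  D \in net_intervals rho d (n + k) -> sub_itv D E ->
  exists s : seq (cvec R), [/\ size s = k, admissible rho d (charvec rho d n E) s,
    last (charvec rho d n E) s = charvec rho d (n + k) D &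
    forall (j : 'I_(size (nbhs_list (charvec rho d n E))))
      (i : 'I_(size (nbhs_list (last (charvec rho d n E) s)))) t w,
      size t = n -> size w = k -> covers (t ++ w) D ->
      (nbhs_list (charvec rho d n E))`_j = rho ^- n * (E.1 - S t 0) ->
      (nbhs_list (last (charvec rho d n E) s))`_i
        = rho ^- (n + k) * (D.1 - S (t ++ w) 0) ->
      0 < path_transition rho d p (charvec rho d n E) s j i].
Proof.
elim: k n E => [|k IH] n E En Dk DE.
  exists [::]; have DEq : D = E.
    move: Dk; rewrite addn0 => Dn; have [_ _ D12 _] := (net_intervalP _ _).1 Dn.
    by apply: (net_interval_unique Dn En D12 _ DE); rewrite /sub_itv !lexx.
  subst E; split=> //; rewrite ?addn0 //.
    by split=> // x; rewrite inE => /eqP->; exact: Omega_charvec.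
  (* The matrix is the identity here. The indices [j] and [i] give the same value in a list without
     repetitions, so they are equal. *)
  move=> j i t w _ /size0nil-> _; rewrite cats0 => <- /eqP.
  rewrite nth_uniq ?ltn_ord //; last exact: neighbours_uniq.
  by move=> ij /=; rewrite mxE eq_sym -val_eqE /= ij.
have nk : (n.+1 <= n + k.+1)%N by rewrite addnS ltnS leq_addr.
have [E1 E1n DE1] := ancestor nk Dk.
have [_ _ D12 _] := (net_intervalP _ _).1 Dk.
have E1E : sub_itv E1 E.
  move: DE DE1 => /andP[h1 h2] /andP[h3 h4].
  by apply: (sub_net_interval (leqnSn n) E1n En); lra.
have nkE : (n + k.+1 = n.+1 + k)%N by rewrite addSnnS.
have Dk' := Dk; rewrite nkE in Dk'.
have [s [sk [Os ps] ls pos]] := IH _ _ E1n Dk' DE1.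
have rE1 : realizes rho d (charvec rho d n E) (charvec rho d n.+1 E1) (n, E1).
  by split; rewrite // (parentE E1n En E1E).
exists (charvec rho d n.+1 E1 :: s); split; rewrite ?nkE //=.
- by rewrite sk.
- split; first by move=> x; rewrite inE => /predU1P[->|/Os//]; exact: Omega_charvec.
  by rewrite /= ps andbT; apply/asboolP; exists (n, E1).
move=> j i t [//|l w] tn [wk]; rewrite -cat_rcons => cD Vj Vi.
have tl : size (rcons t l) = n.+1 by rewrite size_rcons tn.
have ctl : covers (rcons t l) E1.
  by apply: (covers_up _ _ Dk' E1n DE1); rewrite ?tl ?leq_addr //; exact: covers_catl cD.
have: rho ^- n.+1 * (E1.1 - S (rcons t l) 0) \in neighbours rho d n.+1 E1.
  by apply/neighboursP; exists (rcons t l).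
(* [i1] is the index of the neighbour of [E1] defined by [rcons t l]; its summand in the matrix
   product is positive and the others are nonnegative. *)
move=> /[dup] cV; rewrite -index_mem => i1lt.
pose i1 := Ordinal i1lt; rewrite mxE (bigD1 i1) //= ltr_wpDr //.
  by rewrite sumr_ge0 // => *; rewrite mulr_ge0 ?transition_ge0 ?path_transition_ge0.
have Vi1 : (nbhs_list (charvec rho d n.+1 E1))`_i1 = rho ^- n.+1 * (E1.1 - S (rcons t l) 0).
  exact: nth_index.
rewrite mulr_gt0 //; last exact: (pos i1 i (rcons t l) w).
apply: (transition_gt0 (l := l) rE1); rewrite Vi1 Vj (parentE E1n En E1E) //.
rewrite -cats1 sim_word_cat (sim_wordE t (S [:: l] 0)) tn /= /sim mulr0 add0r.
by rewrite exprS; field; rewrite rho_neq0 rhoX_neq0.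
Qed.

End Transition.

(** * Common descendants of all neighbours *)

(** Neighbours lie in [0,1], so two of them differ by at most 1, which is the constant of the finite
    type condition. Hence subtracting a fixed neighbour maps the list injectively into [F] and its
    negatives. Level 0 is left out, as in that condition. *)
Lemma neighbours_bounded : finite_type rho d ->
  exists M, forall n D, (0 < n)%N -> D \in net_intervals rho d n ->
    (size (neighbours rho d n D) <= M)%N.
Proof.
case=> F [/finite_seqP[f ->] _ ftF].
have V01 n D x : D \in net_intervals rho d n ->
    x \in neighbours rho d n D -> 0 <= x <= 1.
  move=> /net_intervalP[_ _ D12 _] /neighboursP[s [sn /andP[/= h1 h2] ->]]; move: h2.
  rewrite sim_word_width sn => h2.
  rewrite mulr_ge0 ?invr_ge0 ?(ltW (rhoX_gt0 _)) ?subr_ge0 //=.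
  by rewrite mulrC ler_pdivrMr // mul1r; lra.
exists (size (f ++ map -%R f)) => n D n_gt0 Dn.
case VE : (neighbours rho d n D) => [//|x0 V]; rewrite -VE.
have x0V : x0 \in neighbours rho d n D by rewrite VE mem_head.
rewrite -(size_map (fun x => x - x0)); apply: uniq_leq_size.
  by rewrite map_inj_uniq ?neighbours_uniq //; exact: addIr.
move=> _ /mapP[x xV ->].
suff : `|x - x0| \in f.
  rewrite mem_cat; case: ger0P => _ xf; first by rewrite xf.
  by apply/orP; right; apply/mapP; exists (- (x - x0)); rewrite ?opprK.
have := V01 _ _ _ Dn xV; have := V01 _ _ _ Dn x0V.
case/neighboursP: xV x0V => s [sn _ ->] /neighboursP[t [tn _ ->]] b1 b2.
move/eqP: sn => sn; move/eqP: tn => tn.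
case: (ftF n (Tuple sn) (Tuple tn) n_gt0) => /=.
- rewrite d_lo d_hi subr0 mulVf => [|]; last by rewrite gt_eqF // subr_gt0; case/andP: rho01.
  rewrite -[X in X * `|_|](gtr0_norm (_ : 0 < _)) ?invr_gt0 // -normrM => gt1.
  have: `|rho ^- n * (D.1 - S s 0) - rho ^- n * (D.1 - S t 0)| <= 1.
    by rewrite ler_norml; lra.
  rewrite leNgt => /negP[]; move: gt1; rewrite -normrN; congr (_ < `|_|); ring.
- rewrite -[X in X * `|_|](gtr0_norm (_ : 0 < _)) ?invr_gt0 // -normrM -normrN => inf.
  suff -> : rho ^- n * (D.1 - S s 0) - rho ^- n * (D.1 - S t 0)
      = - (rho ^- n * (S s 0 - S t 0)) by [].
  by ring.
Qed.

Lemma exists_max_neighbours : finite_type rho d ->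
  exists n D, D \in net_intervals rho d n /\
    forall k C, (0 < k)%N -> C \in net_intervals rho d k ->
      (size (neighbours rho d k C) <= size (neighbours rho d n D))%N.
Proof.
case/neighbours_bounded=> M leM.
pose P i := `[< exists n D, [/\ (0 < n)%N, D \in net_intervals rho d n &
  i = size (neighbours rho d n D)] >].
have [i /asboolP[n [D [n_gt0 Dn ->]]] maxi] : exists2 i, P i & forall j, P j -> (j <= i)%N.
  have exP : exists i, P i.
    have [w _ D1] := net_interval_at (endpoints0 1) (endpoints1 1) ltr01.
    by exists (size (neighbours rho d 1 (0, w))); apply/asboolP; exists 1%N, (0, w).
  have leP i : P i -> (i <= M)%N by move/asboolP=> [n [D [n_gt0 Dn ->]]]; exact: leM.
  by exists (ex_maxn exP leP); case: ex_maxnP.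
exists n, D; split=> // k C k_gt0 Ck.
by apply: maxi; apply/asboolP; exists k, C.
Qed.

Lemma exists_word_within {n t D} : D \in net_intervals rho d n -> covers t D ->
  exists2 w, (n < size (t ++ w))%N & D.1 <= S (t ++ w) 0 /\ S (t ++ w) 1 <= D.2.
Proof.
move=> /net_intervalP[_ _ D12 _] /andP[/= h1 h2].
have [N rhoN] : exists N, rho ^+ N < (D.2 - D.1) / 2.
  have e0 : 0 < (D.2 - D.1) / 2 by lra.
  have : rho ^+ k @[k --> \oo] --> (0 : R).
    by apply: cvg_expr; rewrite ger0_norm //; case/andP: rho01.
  move/cvgrPdist_lt => /(_ _ e0)[N _ /(_ N (leqnn N))].
  by rewrite sub0r normrN ger0_norm ?(ltW (rhoX_gt0 _)) // => ?; exists N.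
(* A word around the midpoint of [D] and shorter than half of [D] stays inside [D]. [N] letters make
   it short enough, and [n.+1] more make its length exceed [n]. *)
have [|w wN] := @word_cover (N + n.+1) t ((D.1 + D.2) / 2); first lra.
have : rho ^+ size (t ++ w) <= rho ^+ N.
  by apply: ler_wiXn2l => //; [case/andP: rho01 => _ /ltW|rewrite size_cat wN addnCA leq_addr].
move=> rhow; rewrite sim_word_width => /andP[h3 h4]; exists w.
  by rewrite size_cat wN addnA addnS ltnS leq_addl.
by split; rewrite ?sim_word_width; lra.
Qed.

(* [E] contains a copy S_{tw}(D0) of a net interval D0 with the maximal number
   of neighbours. The neighbours of D0 give as many neighbours of the copy, all
   of them descending from [t], so by maximality there are no others. *)
Lemma exists_descendant n t E : finite_type rho d ->
  E \in net_intervals rho d n -> (size t <= n)%N -> covers t E ->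
  exists k D, [/\ (n < k)%N, D \in net_intervals rho d k, sub_itv D E &
    forall v, size v = k -> covers v D ->
      exists2 w, size (t ++ w) = k & S (t ++ w) 0 = S v 0].
Proof.
move=> ft En tn ctE.
have [n0 [D0 [D0n0 maxD0]]] := exists_max_neighbours ft.
have [w ntw [Ew wE]] := exists_word_within En ctE.
have [T TE] : exists T, T = t ++ w by exists (t ++ w).
rewrite -TE in ntw Ew wE.
have copy x : x \in endpoints rho d n0 -> S T x \in endpoints rho d (size T + n0).
  case/endpointsP=> s sn0 xs; apply/endpointsP; exists (T ++ s).
    by rewrite size_cat sn0.
  by case: xs => ->; rewrite !sim_word_cat; [left|right].
have [D01 D02 D012 _] := (net_intervalP _ _).1 D0n0.
have lt_copy : S T D0.1 < S T D0.2.
  by rewrite (sim_wordE T D0.1) (sim_wordE T D0.2) ltrD2r ltr_pM2l.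
(* The copy of [D0] may be cut by endpoints of other words, so [D] is only the net interval at its
   left end. The common left end suffices to compare offsets. *)
have [b bD Dk] := net_interval_at (copy _ D01) (copy _ D02) lt_copy.
set k := (size T + n0)%N in Dk; set D := (_, b) in Dk.
have D0_01 := (endpoints_itv D01, endpoints_itv D02).
exists k, D; split=> //; first by rewrite ltn_addr.
  move: D0_01; rewrite /sub_itv /D /= => -[/andP[h1 _] /andP[_ h2]].
  by rewrite (le_trans Ew (sim_word_le _ h1))
    (le_trans bD (le_trans (sim_word_le _ h2) wE)).
have kE s : rho ^- k * (D.1 - S (T ++ s) 0) = rho ^- n0 * (D0.1 - S s 0).
  rewrite sim_word_cat /D /= (sim_wordE T) (sim_wordE T (S s 0)) /k exprD.
  by field; rewrite !rhoX_neq0.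
have subV : {subset neighbours rho d n0 D0 <= neighbours rho d k D}.
  move=> x /neighboursP[s [sn0 /andP[/= h1 h2] ->]].
  apply/neighboursP; exists (T ++ s); rewrite size_cat sn0 kE; split=> //.
  rewrite /sub_itv /D /= !sim_word_cat sim_word_le //.
  by rewrite (le_trans bD) // sim_word_le.
(* [D] has all the neighbours of [D0] and, by maximality, no more of them, so the two lists have the
   same members. Maximality applies because [k] exceeds [n] and is thus positive. *)
have [|_ eqV] := uniq_min_size (neighbours_uniq n0 D0) subV.
  by apply: maxD0 => //; rewrite (leq_ltn_trans (leq0n n)) // ltn_addr.
move=> v vk cv.
have: rho ^- k * (D.1 - S v 0) \in neighbours rho d k D by apply/neighboursP; exists v.
rewrite -eqV => /neighboursP[s [sn0 _]]; rewrite -kE.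
move/(mulfI (_ : rho ^- k != 0)); rewrite invr_eq0 => /(_ (rhoX_neq0 _)) eqS.
exists (w ++ s); rewrite catA -TE ?size_cat ?sn0 //.
by apply/esym; move: eqS; lra.
Qed.

(** The words are treated one at a time, each time passing to a smaller interval. Descent is
    expressed by equality of points rather than of words, since different words can define the same
    neighbour. Each step raises the level, whence the bound on [k]. *)
Lemma exists_common_descendant n (ts : seq (seq 'I_m.+1)) E : finite_type rho d ->
  E \in net_intervals rho d n ->
  (forall t, t \in ts -> size t = n /\ covers t E) ->
  exists k D, [/\ (n + size ts <= k)%N, D \in net_intervals rho d k, sub_itv D E &
    forall t v, t \in ts -> size v = k -> covers v D ->
      exists2 w, size (t ++ w) = k & S (t ++ w) 0 = S v 0].
Proof.
move=> ft En; elim: ts => [|t ts IH] cts.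
  by exists n, E; split; rewrite ?addn0 // /sub_itv !lexx.
have [|k [D [nk Dk DE from_ts]]] := IH.
  by move=> t' t'ts; apply: cts; rewrite in_cons t'ts orbT.
have [tn ctE] := cts t (mem_head _ _).
have ctD : covers t D by exact: sub_itv_trans DE ctE.
have tk : (size t <= k)%N by rewrite tn (leq_trans (leq_addr _ _) nk).
have [k' [D' [kk' D'k' D'D from_t]]] := exists_descendant ft Dk tk ctD.
exists k', D'; split=> //; [by rewrite /= addnS (leq_ltn_trans nk)|exact: sub_itv_trans DE|].
move=> t' v; rewrite in_cons => /predU1P[->|t'ts] vk' cv; first exact: from_t.
(* For a word treated earlier, the prefix of [v] of length [k] covers [D] and so agrees with some
   [t' ++ w]. Equal length and equal value at 0 give the same affine map, so the prefix can be
   exchanged and the rest of [v] kept. *)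
have takev : size (take k v) = k by rewrite size_takel // vk' ltnW.
have ctake : covers (take k v) D.
  apply: (covers_up _ (ltnW kk') D'k' Dk D'D); rewrite ?takev //.
  by rewrite -(cat_take_drop k v) in cv; exact: covers_catl cv.
have [w wk Sw] := from_ts t' _ t'ts takev ctake.
exists (w ++ drop k v).
  by rewrite catA size_cat wk size_drop vk' subnKC // ltnW.
rewrite catA -[in RHS](cat_take_drop k v) (sim_word_cat (t' ++ w)) (sim_word_cat (take k v)).
by rewrite (sim_wordE (t' ++ w)) wk Sw (sim_wordE _ (S (drop k v) 0)) takev.
Qed.

Lemma essential_positive_type {p : 'I_m.+1 -> R} {O : set (cvec R)} :
  (forall j, 0 < p j) -> finite_type rho d -> essential_class rho d O ->
  positive_type rho d p O.
Proof.
move=> p_gt0 ft [[[g Og] OOmega _] Ochild].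
have [n [E [En gE]]] := OOmega _ Og; subst g.
pose ts := [seq tval u | u <- enum {: n.-tuple 'I_m.+1} & covers (tval u) E].
have tsP t : size t = n -> covers t E -> t \in ts.
  move=> /eqP tn ct; apply/mapP; exists (Tuple tn) => //.
  by rewrite mem_filter mem_enum andbT.
have cts t : t \in ts -> size t = n /\ covers t E.
  case/mapP=> s; rewrite mem_filter => /andP[cs _] ->.
  by split=> //; exact: size_tuple.
(* Some word covers [E], for instance one around its midpoint. This forces [k] above [n], so that
   the path has at least two members. *)
have ts_gt0 : (0 < size ts)%N.
  have [E1 E2 E12 _] := (net_intervalP _ _).1 En.
  have := endpoints_itv E1; have := endpoints_itv E2 => b2 b1.
  have [|t /= tn /andP[h1 h2]] := @word_cover n [::] ((E.1 + E.2) / 2) => /=; first lra.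
  suff : t \in ts by case: (ts).
  by apply: tsP => //; apply: (covers_net_interval _ En); rewrite ?tn //; lra.
have [k [D [nk Dk DE from_ts]]] := exists_common_descendant ft En cts.
have ltnk : (n < k)%N by apply: leq_trans nk; rewrite -addn1 leq_add2l.
rewrite -(subnKC (ltnW ltnk)) in Dk.
have [s [sk As ls pos]] := exists_path p_gt0 En Dk DE.
exists (charvec rho d n E), s; split=> //.
- by move=> s0; move: sk ltnk; rewrite s0 -subn_gt0 => <-.
(* The path starts in [O], and closure under children keeps it there. *)
- case: As => _; elim: s (charvec rho d n E) Og {sk ls pos} => [|b s IH] a Oa /=.
    by move=> _ x; rewrite inE => /eqP->.
  case/andP=> /asboolP ab /IH{}IH x; rewrite in_cons => /predU1P[->//|].
  exact: IH (Ochild _ _ Oa ab) _.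
move=> j i.
have /neighboursP[t [tn ct Vj]] := mem_nth 0 (ltn_ord j).
have : (nbhs_list (last (charvec rho d n E) s))`_i \in
    neighbours rho d (n + (k - n)) D.
  (* The type of [i] depends on the end of the path, so the value at [i] is abstracted before
     rewriting with [ls]. *)
  have := mem_nth 0 (ltn_ord i); set x := _`_i; clearbody x.
  by rewrite ls.
case/neighboursP=> v [vk cv Vi].
have vk' : size v = k by rewrite vk subnKC // ltnW.
have [w wk Sw] := from_ts t v (tsP _ tn ct) vk' cv.
apply: (pos j i t w) => //; rewrite ?Sw //.
  by move: wk; rewrite size_cat tn => <-; rewrite addKn.
(* [t ++ w] and [v] have the same length and the same left end, hence the same image of [0,1]. *)
by move: cv; rewrite /sub_itv /= !sim_word_width Sw wk vk'.
Qed.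

End Words.

Theorem proposition4p12 (R : realType) (m : nat) (rho : R)
  (d p : 'I_m.+1 -> R) (mu : probability (measurableTypeR R) R)
  (Omega0 : set (cvec R))
  (hm : (1 <= m)%N)
  (hrho : 0 < rho < 1)
  (hd : forall i j : 'I_m.+1, (i < j)%N -> d i < d j)
  (hp : forall j, 0 < p j)
  (hp1 : \sum_(j < m.+1) p j = 1)
  (hmu : self_similar rho d p mu)
  (hfin : finite_type rho d)
  (hp0m : p ord0 = p ord_max)
  (hpmin : forall j, p ord0 <= p j)
  (hsupp : msupport mu = [set x | 0 <= x <= 1])
  (hess : essential_class rho d Omega0) :
  positive_type rho d p Omega0.
Proof.
have d_itv := translation_itv hp hmu hsupp.
have d_cover := unit_itv_cover hrho hmu hsupp.
have d_lo := translation_ord0 hrho hp hmu hsupp hd.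
have d_hi := translation_ord_max hrho hp hmu hsupp hd.
exact: (essential_positive_type hrho d_itv d_lo d_hi d_cover hp hfin hess).
Qed.
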